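(* There is an absolute constant $c>0$ such that the following holds. Let $A$ be a symmetric $n\times n$ random matrix with entries $A_{ij}=A_{ji}=Y_{ij}$ for $i\le j$, where the $Y_{ij}$ ($i\le j$) are independent random variables, each moment bounded with parameter $L=1$ and with $\mathbb E[Y_{ij}]=0$. Let $P(A)$ be the permanent of $A$. Then for every $t>0$, $$\Pr\big[|P(A)|\ge t\sqrt{n!}\big]\le \max\left\{e^{-n},\ e^2\cdot e^{-c\,t^{2/n}}\right\}.$$
   Context: A random variable $Z$ is moment bounded with parameter $L>0$ if for every integer $i\ge1$, $\mathbb E[|Z|^i]\le iL\,\mathbb E[|Z|^{i-1}]$. The permanent of $A$ is $\sum_{\pi\in S_n}\prod_{i=1}^nA_{i\pi(i)}$. *)

(* Defs.v *)
From HB Require Import structures.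
From mathcomp Require Import all_boot all_order all_algebra all_fingroup.
From mathcomp Require Import all_classical all_reals all_analysis.
Set Implicit Arguments. Unset Strict Implicit. Unset Printing Implicit Defensive.
Import Order.TTheory GRing.Theory Num.Theory.
Local Open Scope classical_set_scope.
Local Open Scope ring_scope.

Definition permanent (R : comNzRingType) (n : nat) (A : 'M[R]_n) : R :=
  \sum_(s : 'S_n) \prod_(i < n) A i (s i).

Definition moment_bounded d (T : measurableType d) (R : realType)
  (P : probability T R) (L : R) (Z : T -> R) : Prop :=
  forall i : nat, (1 <= i)%N ->
    ('E_P[fun w => (`|Z w| ^+ i)%R] <=
       (i%:R * L)%:E * 'E_P[fun w => (`|Z w| ^+ i.-1)%R])%E.

Definition mutually_independent d (T : measurableType d) (R : realType)
  (P : probability T R) (K : finType) (I : {set K}) (X : K -> T -> R) : Prop :=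
  forall B : K -> set R, (forall k, measurable (B k)) ->
    P (\bigcap_(k in [set k | k \in I]) (X k @^-1` B k)) =
    (\prod_(k in I) P (X k @^-1` B k))%E.

Definition sym_of_upper (R : Type) (n : nat) (Y : 'I_n -> 'I_n -> R) : 'M[R]_n :=
  \matrix_(i, j) (if (i <= j)%N then Y i j else Y j i).

(* Main.v *)
(* The second moment suffices. Expanding E[P(A)^2] over pairs of permutations
   (p, s), independence turns each term into a product of moments of the
   entries. It vanishes unless every edge {i, j} used by the pair is used at
   least twice, and it is then at most 9^n, since multiplicities are at most 4,
   they sum to 2n, and E|Y|^m <= m! <= 3^m for m <= 4. For such a pair the edges
   form a graph of maximal degree 2; orienting it along a single permutation t
   with p i and s i in {t i, t^-1 i} for every i bounds the number of pairs by
   4^n n!. Hence E[P(A)^2] <= 36^n n!, and Markov's inequality gives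
   Pr <= (36 / t^(2/n))^n, which is at most e^-n once t^(2/n) >= 36 e. For
   smaller t the other term of the maximum exceeds 1 if c = 2 / (36 e). *)
Require Import Defs.
From HB Require Import structures.
From mathcomp Require Import all_boot all_order all_algebra all_fingroup.
From mathcomp Require Import all_classical all_reals all_analysis.
From mathcomp Require Import measurable_realfun.
Set Implicit Arguments. Unset Strict Implicit. Unset Printing Implicit Defensive.
Import Order.TTheory GRing.Theory Num.Theory.

(** * Pairs of permutations that cover each other, and their number *)

Section coverings.
Context {n : nat}.
Implicit Types (p s t : 'S_n) (i j : 'I_n).

Definition in_2cycle p i := (p (p i) == i) && (p i != i).

(* No edge {i, p i} occurs exactly once among the edges of p and s. *)
Definition covered p s :=
  [forall i, [|| in_2cycle p i, s i == p i | s (p i) == i]].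

Lemma covered_or p s i : covered p s -> ~~ in_2cycle p i ->
  s i = p i \/ s (p i) = i.
Proof.
move=> /forallP/(_ i) + /negPf i2; rewrite i2 /=.
by case/orP=> /eqP; [left|right].
Qed.

(** Fixed points aside, if [s (p i) = i] then the edge entering [i] from [j = p^-1 i] must be
    covered too: [s j = i] would force [j = p i], a 2-cycle, so [s i = j]. *)
Lemma covered_out p s i : covered p s -> ~~ in_2cycle p i ->
  s i = p i \/ p (s i) = i.
Proof.
move=> ps ni; have [->|spi] := covered_or ps ni; first by left.
have [pii|pii] := eqVneq (p i) i.
  by left; rewrite pii -[RHS]spi pii.
set j := (p^-1)%g i.
have pj : p j = i by rewrite /j permKV.
have nj : ~~ in_2cycle p j.
  apply: contra ni => /andP[/eqP]; rewrite pj => pij _.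
  by rewrite /in_2cycle pij pj eqxx -pij pii.
have [|] := covered_or ps nj; rewrite pj => sj.
  have jpi : j = p i by apply: (@perm_inj _ s); rewrite sj spi.
  by case/negP: ni; rewrite /in_2cycle -jpi pj eqxx jpi pii.
by right; rewrite sj.
Qed.

(** The edges of [s] into and out of [i] must be covered, but the only edge of [p] at [i] is
    [{i, p i}]. So the successor and the predecessor of [i] under [s] are both [p i]. *)
Lemma covered_in p s i : covered p s -> covered s p ->
  in_2cycle p i -> in_2cycle s i.
Proof.
move=> ps sp /andP[/eqP ppi pi]; apply/negPn/negP => ni.
have [sii|sii] := eqVneq (s i) i.
  have [e|e] := covered_or sp ni; first by rewrite e sii eqxx in pi.
  by rewrite sii in e; rewrite e eqxx in pi.
have sipi : s i = p i.
  have [->//|psi] := covered_or sp ni.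
  by apply: (@perm_inj _ p); rewrite psi ppi.
set j := (s^-1)%g i.
have sj : s j = i by rewrite /j permKV.
have nj : ~~ in_2cycle s j.
  apply: contra ni => /andP[/eqP]; rewrite sj => sij _.
  by rewrite /in_2cycle sij sj eqxx -sij sii.
have pij : p i = j.
  have [|] := covered_or sp nj; rewrite sj => // pj.
  by apply: (@perm_inj _ p); rewrite ppi pj.
by case/negP: ni; rewrite /in_2cycle sipi pij sj eqxx -pij.
Qed.

Lemma in_2cycle_perm p i : in_2cycle p (p i) = in_2cycle p i.
Proof.
rewrite /in_2cycle !(inj_eq perm_inj).
by case: eqP => //= /eqP; rewrite eq_sym => /eqP ->.
Qed.

(** * Orienting the common 2-cycles through a dihedral group action *)

Section dihedral.
Context (p s : 'S_n).
Hypotheses (ps : covered p s) (sp : covered s p).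

Let rho := (p * s)%g.

Let in2 i : in_2cycle s i = in_2cycle p i.
Proof. by apply/idP/idP; exact: covered_in. Qed.

Let pK i : in_2cycle p i -> p (p i) = i.
Proof. by case/andP=> /eqP. Qed.

Let sK i : in_2cycle p i -> s (s i) = i.
Proof. by rewrite -in2 => /andP[/eqP]. Qed.

Let in2_s i : in_2cycle p (s i) = in_2cycle p i.
Proof. by rewrite -!in2 in_2cycle_perm. Qed.

(* A reflection of the dihedral group generated by two fixed-point-free
   involutions, applied to i, never lands in the rotation orbit of i. *)
Lemma rotation_reflection i k : in_2cycle p i -> p i != (rho ^+ k)%g i.
Proof.
have [m] := ubnP k; elim: m k i => // m IH [|[|k]] i km i2.
- by rewrite expg0 perm1; case/andP: i2.
- rewrite expg1 permM eq_sym; have := i2; rewrite -in_2cycle_perm -in2.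
  by case/andP.
- have ri2 : in_2cycle p (rho i) by rewrite permM in2_s in_2cycle_perm.
  (* Since [rho * p * rho = p] on the common 2-cycles, an equality at [i] with exponent [k + 2]
     yields one at [rho i] with exponent [k]. *)
  have := IH k (rho i) (ltnW (ltnSE km)) ri2; apply: contra => /eqP pi.
  apply/eqP/(@perm_inj _ rho).
  transitivity (p i).
    by rewrite !permM pK ?in2_s ?in_2cycle_perm // sK ?in_2cycle_perm.
  by rewrite pi expgSr expgS !permM.
Qed.

(** On a 2-cycle the rotation orbits of [i] and [p i] are distinct by [rotation_reflection];
    comparing their ranks marks exactly one of the two points. *)
Let color i := (enum_rank (porbit rho i) < enum_rank (porbit rho (p i)))%N.

Let color_p i : in_2cycle p i -> color (p i) = ~~ color i.
Proof.
move=> i2; rewrite /color pK // -leqNgt ltn_neqAle; apply/andb_idl => _.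
apply/negP => /eqP/val_inj/enum_rank_inj e.
have := porbit_id rho (p i); rewrite e => /porbitP[k pk].
by have /eqP := rotation_reflection k i2.
Qed.

(** [s i] is the image of [p i] under [rho], so it lies in the same rotation orbit. *)
Let color_s i : in_2cycle p i -> color (s i) = ~~ color i.
Proof.
move=> i2; rewrite -color_p // /color pK //.
have e j : porbit rho (rho j) = porbit rho j.
  by apply/eqP; rewrite eq_porbit_mem -{1}(expg1 rho) mem_porbit.
by rewrite -[porbit _ (p i)]e -[porbit _ (p (s i))]e !permM !pK ?in2_s ?sK.
Qed.

(* On the common 2-cycles the two involutions form alternating even cycles;
   the colour orients them. *)
Lemma covered_common_orientation : exists t : 'S_n, forall i,
  ((t i == p i) || (t (p i) == i)) && ((t i == s i) || (t (s i) == i)).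
Proof.
(* Off the 2-cycles follow [p]; on them leave a marked point by [p] and an unmarked one by [s]. Both
   flip the mark, so the mark of the image tells [g] which map to undo. *)
pose f i := if in_2cycle p i && ~~ color i then s i else p i.
pose g i := if in_2cycle p i then if color i then s i else p i else (p^-1)%g i.
have fK : cancel f g.
  move=> i; rewrite /f /g; have [i2|i2] := boolP (in_2cycle p i) => /=;
    last first.
    by rewrite in_2cycle_perm (negPf i2) permK.
  have [ci|ci] := boolP (color i) => /=.
    by rewrite in_2cycle_perm i2 color_p // ci pK.
  by rewrite in2_s i2 color_s // ci sK.
exists (perm (can_inj fK)) => i; rewrite !permE /f in_2cycle_perm.
have [i2|i2] := boolP (in_2cycle p i) => /=; last first.
  (* Here [s i] is the successor or the predecessor of [i] under [p]; in the second case it is off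
     the 2-cycles as well, so [t] sends it back to [i]. *)
  rewrite eqxx /=; have [->|psi] := covered_out ps i2; first by rewrite eqxx.
  suff -> : in_2cycle p (s i) = false by rewrite psi eqxx orbT.
  by apply: contraNF i2 => si2; rewrite -psi in_2cycle_perm.
by rewrite in2_s i2 color_p // color_s //=; case: color => /=;
  rewrite ?pK ?sK // !eqxx ?orbT.
Qed.
End dihedral.

(** A pair is recovered from a common orientation [t] and two bits per index, which tell whether
    [p i] and [s i] are [t i] or [t^-1 i]. *)
Lemma card_covered :
  (#|[set ps : 'S_n * 'S_n | covered ps.1 ps.2 && covered ps.2 ps.1]| <=
     n`! * 4 ^ n)%N.
Proof.
pose oriented (ps : 'S_n * 'S_n) (t : 'S_n) := [forall i,
  ((t i == ps.1 i) || (t (ps.1 i) == i)) &&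
  ((t i == ps.2 i) || (t (ps.2 i) == i))].
(* The default is never reached on the pairs counted, by [covered_common_orientation]. *)
pose t ps := odflt 1%g [pick t | oriented ps t].
pose code (ps : 'S_n * 'S_n) :
    'S_n * ({ffun 'I_n -> bool} * {ffun 'I_n -> bool}) :=
  (t ps, ([ffun i => t ps i == ps.1 i], [ffun i => t ps i == ps.2 i])).
have codeP ps i : covered ps.1 ps.2 && covered ps.2 ps.1 ->
    ps.1 i = (if (code ps).2.1 i then (code ps).1 i else ((code ps).1^-1)%g i) /\
    ps.2 i = (if (code ps).2.2 i then (code ps).1 i else ((code ps).1^-1)%g i).
  case/andP=> c12 c21; rewrite /code /= !ffunE.
  have : oriented ps (t ps).
    rewrite /t; case: pickP => //= none.
    have [u /forallP ou] := covered_common_orientation c12 c21.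
    by have := none u; rewrite /oriented ou.
  move=> /forallP/(_ i)/andP[tp ts]; split.
    by move: tp; case: eqP => //= _ /eqP e; rewrite -[in RHS]e permK.
  by move: ts; case: eqP => //= _ /eqP e; rewrite -[in RHS]e permK.
have code_inj :
  {in [set ps : 'S_n * 'S_n | covered ps.1 ps.2 && covered ps.2 ps.1] &,
    injective code}.
  move=> [p s] [p' s']; rewrite !inE => c c' e.
  clearbody code; by congr pair; apply/permP => i;
    have [/= e1 e2] := codeP _ i c;
    have [/= e1' e2'] := codeP _ i c'; rewrite ?e1 ?e2 ?e1' ?e2' e.
rewrite -(card_in_imset code_inj) (leq_trans (max_card _)) //.
by rewrite !card_prod card_ffun card_bool card_ord -expnMn card_Sn.
Qed.
End coverings.

(** * Edge multiplicities in a pair of permutations *)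

Section multiplicities.
Context {n : nat}.
Implicit Types (p s : 'S_n) (i j : 'I_n) (e : 'I_n * 'I_n).

(** An unordered pair, loops allowed, is stored with its smaller end first so that it indexes the
    variable read by [sym_of_upper]. *)
Definition edge i j : 'I_n * 'I_n := if i <= j then (i, j) else (j, i).

Definition edges p e : {set 'I_n} := [set i | edge i (p i) == e].

(** This is the exponent of the variable at [e] in the product of the permanent terms of [p] and
    [s]. *)
Definition multiplicity p s e := #|edges p e| + #|edges s e|.

Lemma edge_le i j : (edge i j).1 <= (edge i j).2.
Proof. by rewrite /edge; case: (leqP i j) => // /ltnW. Qed.

Lemma edge_eq i j i' j' : edge i j = edge i' j' ->
  (i = i' /\ j = j') \/ (i = j' /\ j = i').
Proof.
by rewrite /edge; case: leqP => _; case: leqP => _ -[-> ->]; auto.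
Qed.

(** An index whose edge is [e] is one of the two ends of [e]. *)
Lemma card_edges_le2 p e : #|edges p e| <= 2.
Proof.
apply: leq_trans (_ : #|[set e.1; e.2]| <= 2); last by rewrite cards2; case: eqP.
apply/subset_leq_card/fintype.subsetP => i; rewrite !inE /edge.
by case: leqP => _ /eqP <- /=; rewrite eqxx ?orbT.
Qed.

Lemma multiplicity_le4 p s e : multiplicity p s e <= 4.
Proof. exact: leq_add (card_edges_le2 p e) (card_edges_le2 s e). Qed.

Lemma sum_card_edges p : \sum_(e : 'I_n * 'I_n | e.1 <= e.2) #|edges p e| = n.
Proof.
rewrite -[RHS]card_ord -sum1_card.
rewrite (partition_big (fun i => edge i (p i))
  (fun e : 'I_n * 'I_n => e.1 <= e.2)) /=; last first.
  by move=> i _; exact: edge_le.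
apply: eq_bigr => e _; rewrite -sum1_card; apply: eq_bigl => i.
by rewrite !inE.
Qed.

Lemma sum_multiplicity p s :
  \sum_(e : 'I_n * 'I_n | e.1 <= e.2) multiplicity p s e = n + n.
Proof. by rewrite big_split /= !sum_card_edges. Qed.

(** After its use at [i], the edge [{i, p i}] can recur only in [p] at [p i], closing a 2-cycle, or
    in [s] at one of its ends: the three clauses of [covered]. *)
Lemma covered_multiplicity p s :
  (forall e, e.1 <= e.2 -> multiplicity p s e != 1) -> covered p s.
Proof.
move=> m1; apply/forallP => i; set e := edge i (p i).
have ie : i \in edges p e by rewrite inE.
have [/existsP[j /andP[ji]]|no] := boolP [exists j, (j != i) && (j \in edges p e)].
  rewrite inE => /eqP/edge_eq[[jie]|[jpi pj]]; first by rewrite jie eqxx in ji.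
  by rewrite /in_2cycle -[p i]jpi pj eqxx ji.
have e1 : edges p e = [set i]%SET.
  apply/setP => j; rewrite finset.in_set1; apply/idP/eqP => [je|->//].
  by apply: contraNeq no => ji; apply/existsP; exists j; rewrite ji.
have := m1 e (edge_le _ _); rewrite /multiplicity e1 cards1 -[X in _ != X]addn0.
rewrite eqn_add2l cards_eq0 => /set0Pn[j].
rewrite inE => /eqP/edge_eq[[-> ->]|[-> ->]].
  by rewrite eqxx orbT.
by rewrite eqxx !orbT.
Qed.

Lemma multiplicityC p s e : multiplicity p s e = multiplicity s p e.
Proof. exact: addnC. Qed.

Lemma prod_fact_multiplicity p s :
  \prod_(e : 'I_n * 'I_n | e.1 <= e.2) (multiplicity p s e)`! <= 9 ^ n.
Proof.
have fact3 m : m <= 4 -> m`! <= 3 ^ m by case: m => [|[|[|[|[|]]]]].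
apply: leq_trans
  (_ : \prod_(e : 'I_n * 'I_n | e.1 <= e.2) 3 ^ multiplicity p s e <= _).
  by apply: leq_prod => e _; exact/fact3/multiplicity_le4.
by rewrite -expn_sum sum_multiplicity addnn -mul2n expnM.
Qed.
End multiplicities.

Local Open Scope classical_set_scope.
Local Open Scope ring_scope.

(** * Splitting off one nonnegative factor from a weighted integral *)

Section weighted_integral.
Context d (T : measurableType d) (R : realType) (P : probability T R).
Variables (W : T -> R) (c : R) (Y : {RV P >-> R}).
Hypotheses (mW : measurable_fun setT W) (W0 : forall w, 0 <= W w).
Hypothesis WY : forall B : set R, measurable B ->
  (\int[P]_w (W w * \1_B (Y w))%:E = c%:E * P (Y @^-1` B))%E.

Import HBNNSimple.

Lemma weighted_integral_nnsfun (f : {nnsfun R >-> R}) :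
  (\int[P]_w (W w * f (Y w))%:E = c%:E * \int[P]_w (f (Y w))%:E)%E.
Proof.
have mfY r : measurable_fun setT (fun w => \1_(f @^-1` [set r]) (Y w) : R).
  exact: measurableT_comp.
have ge0f r x : 0 <= r * \1_(f @^-1` [set r]) x :> R.
  by rewrite -lee_fin EFinM nnfun_muleindic_ge0.
under eq_integral => w _.
  rewrite fimfunEord mulr_sumr -sumEFin.
  over.
under [in RHS]eq_integral => w _.
  rewrite fimfunEord -sumEFin.
  over.
rewrite !ge0_integral_sum//; last first.
- by move=> i w _; rewrite lee_fin mulr_ge0.
- by move=> i; apply/measurable_EFinP; do 2 apply: measurable_funM => //.
- by move=> i w _; rewrite lee_fin.
- by move=> i; apply/measurable_EFinP; apply: measurable_funM => //.
rewrite ge0_sume_distrr; last first.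
  by move=> i _; apply: integral_ge0 => w _; rewrite lee_fin.
apply: eq_bigr => i _; set r := (_`_i).
(* An empty level set leaves the sign of [r] unknown, but then both integrals vanish; otherwise [r]
   is a value of [f]. *)
have r0 : (f @^-1` [set r] = set0) \/ 0 <= r.
  have [|] := pselect (f @^-1` [set r] = set0); first by left.
  by move=> /eqP/set0P[x <-]; right; exact: fun_ge0.
have mB : measurable (f @^-1` [set r]) by [].
have [B0|{}r0] := r0.
  rewrite !integral0_eq ?mule0// => w _;
    by rewrite B0 indicE in_set0 !mulr0.
transitivity (r%:E * \int[P]_w (W w * \1_(f @^-1` [set r]) (Y w))%:E)%E.
  rewrite -ge0_integralZl//.
  - by apply: eq_integral => w _; rewrite mulrCA EFinM.
  - by apply/measurable_EFinP; apply: measurable_funM.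
  - by move=> w _; rewrite lee_fin mulr_ge0.
have -> : (\int[P]_w (r * \1_(f @^-1` [set r]) (Y w))%:E =
           r%:E * \int[P]_w (\1_(f @^-1` [set r]) (Y w))%:E)%E.
  rewrite -ge0_integralZl//.
  exact/measurable_EFinP.
rewrite WY// muleCA; congr (_ * (_ * _))%E.
under eq_integral => w _.
  rewrite (_ : \1_ _ _ = \1_(Y @^-1` (f @^-1` [set r])) w); last by [].
  over.
rewrite integral_indic ?setIT//.
by rewrite -[X in measurable X]setTI; exact: measurable_funP.
Qed.

(** Simple functions increase to [f], and monotone convergence carries the identity to the limit on
    both sides. In the application [W] is the product of the other factors. *)
Lemma weighted_integral (f : R -> R) : measurable_fun setT f ->
  (forall x, 0 <= f x) ->
  (\int[P]_w (W w * f (Y w))%:E = c%:E * \int[P]_w (f (Y w))%:E)%E.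
Proof.
move=> mf f0.
have mEf : measurable_fun setT (EFin \o f) by exact/measurable_EFinP.
pose g := nnsfun_approx measurableT mEf.
have nd_g x : {homo g ^~ x : m n / (m <= n)%N >-> m <= n}.
  by move=> m n mn; exact/lefP/nd_nnsfun_approx.
have cvg_g x : EFin \o g ^~ x @ \oo --> (f x)%:E.
  by apply: cvg_nnsfun_approx => //= y _; rewrite lee_fin.
have mgY n : measurable_fun setT (fun w => g n (Y w)) by exact: measurableT_comp.
have cvg1 : (\int[P]_w (W w * g n (Y w))%:E)%E @[n --> \oo] -->
    (\int[P]_w (W w * f (Y w))%:E)%E.
  rewrite (_ : (\int[P]_w (W w * f (Y w))%:E =
    \int[P]_w limn (fun n => (W w * g n (Y w))%:E))%E); last first.
    apply: eq_integral => w _; apply/esym/cvg_lim => //=.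
    under eq_fun do rewrite EFinM.
    by rewrite EFinM; apply: cvgeZl => //; exact: cvg_g.
  apply: cvg_monotone_convergence => //.
  - by move=> n; apply/measurable_EFinP; exact: measurable_funM.
  - by move=> n w _; rewrite lee_fin mulr_ge0.
  - by move=> w _ m n mn; rewrite lee_fin ler_wpM2l// nd_g.
have cvg2 : (\int[P]_w (g n (Y w))%:E)%E @[n --> \oo] --> (\int[P]_w (f (Y w))%:E)%E.
  rewrite (_ : (\int[P]_w (f (Y w))%:E =
    \int[P]_w limn (fun n => (g n (Y w))%:E))%E); last first.
    by apply: eq_integral => w _; apply/esym/cvg_lim => //=; exact: cvg_g.
  apply: cvg_monotone_convergence => //.
  - by move=> n; exact/measurable_EFinP.
  - by move=> n w _; rewrite lee_fin.
  - by move=> w _ m n mn; rewrite lee_fin nd_g.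
apply: cvg_unique cvg1 _ => //.
rewrite (_ : (fun n => _) = fun n => c%:E * \int[P]_w (g n (Y w))%:E)%E.
  exact: cvgeZl.
by apply/funext => n; exact: weighted_integral_nnsfun.
Qed.

End weighted_integral.

(** * Expectation of a product of functions of independent variables *)

Section independent_products.
Context d (T : measurableType d) (R : realType) (P : probability T R).
Context (K : finType) (I : {set K}) (X : K -> {RV P >-> R}).
Hypothesis indX : mutually_independent P I (fun k => X k : T -> R).

Lemma measurable_prod_comp (Q : pred K) (f : K -> R -> R) :
  (forall k, measurable_fun setT (f k)) ->
  measurable_fun setT (fun w => \prod_(k | Q k) f k (X k w)).
Proof.
move=> mf; under eq_fun do rewrite -big_filter.
apply: measurable_prod => k _; exact: measurableT_comp.
Qed.

Let zero_one_indic (f : R -> R) x : f x = 0 \/ f x = 1 ->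
  f x = \1_(f @^-1` [set 1]) x.
Proof.
rewrite indicE; case: (boolP (x \in _)) => [|/negP]; rewrite inE => /=.
  by move=> ->.
by move=> + [] // => /[swap] ->.
Qed.

Lemma independent_prod_ge0 (f : K -> R -> R) :
  (forall k, measurable_fun setT (f k)) -> (forall k x, 0 <= f k x) ->
  (forall k, k \in I -> \int[P]_w (f k (X k w))%:E < +oo)%E ->
  (\int[P]_w (\prod_(k in I) f k (X k w))%:E =
   \prod_(k in I) \int[P]_w (f k (X k w))%:E)%E.
Proof.
(* Induction on the list of indices where f is not an indicator function. *)
have aux (s : seq K) : forall f : K -> R -> R,
  (forall k, measurable_fun setT (f k)) -> (forall k x, 0 <= f k x) ->
  (forall k, k \in I -> \int[P]_w (f k (X k w))%:E < +oo)%E ->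
  (forall k, k \in I -> k \notin s -> forall x, f k x = 0 \/ f k x = 1) ->
  (\int[P]_w (\prod_(k in I) f k (X k w))%:E =
   \prod_(k in I) \int[P]_w (f k (X k w))%:E)%E; last first.
  by move=> mf f0 ff; apply: (aux (enum K)) => // k _; rewrite mem_enum inE.
elim: s => [|a s IH] {}f mf f0 ff f01.
  (* With indicators only, the product is the indicator of an intersection of events, and the rule
     is independence itself. *)
  pose B k := f k @^-1` [set 1].
  have mB k : measurable (B k) by rewrite -[B k]setTI; exact: mf.
  have mXB k : measurable (X k @^-1` B k).
    by rewrite -[X in measurable X]setTI; exact: measurable_funP.
  have fB k w : k \in I -> f k (X k w) = \1_(X k @^-1` B k) w.
    by move=> kI; rewrite [LHS]zero_one_indic //; exact: f01.
  have := indX mB; rewrite -[X in P X = _]setIT -integral_indic//; last first.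
    by apply: fin_bigcap_measurable => // k _; exact: mXB.
  move=> e; transitivity (\prod_(k in I) P (X k @^-1` B k))%E; last first.
    apply: eq_bigr => k kI; rewrite -[X in P X = _]setIT -integral_indic//.
    by apply: eq_integral => w _; rewrite fB.
  rewrite -e; apply: eq_integral => w _; congr EFin.
  rewrite (eq_bigr (fun k => \1_(X k @^-1` B k) w)); last by move=> k; exact: fB.
  rewrite indicE; case: (boolP (w \in _)) => [|/negP]; rewrite inE /= => h.
    by rewrite big1 // => k kI; rewrite indicE mem_set //; exact: h.
  have [k kI nk] : exists2 k, k \in I & ~ (X k @^-1` B k) w.
    apply: contrapT => no; apply: h => k kI; apply: contrapT => nk.
    by apply: no; exists k.
  by rewrite (bigD1 k) //= indicE memNset // mul0r.
have [aI|aI] := boolP (a \in I); last first.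
  apply: IH => // k kI ks; apply: f01 => //; rewrite inE negb_or ks andbT.
  by apply: contraNneq aI => <-.
have fin k : k \in I -> (\int[P]_w (f k (X k w))%:E)%E \is a fin_num.
  move=> kI; rewrite ge0_fin_numE ?ff// integral_ge0// => w _.
  by rewrite lee_fin.
(* Finiteness lets this product serve as the real constant [c] of [weighted_integral]. *)
have cfin : (\prod_(k in I | k != a) \int[P]_w (f k (X k w))%:E)%E \is a fin_num.
  by apply: prode_fin_num => k /andP[kI _]; exact: fin.
under eq_integral do rewrite (bigD1 a) //= mulrC.
rewrite [RHS](bigD1 a) //= muleC -(fineK cfin).
apply: weighted_integral => //.
- exact: measurable_prod_comp.
- by move=> w; apply: prodr_ge0 => k _.
move=> B mB; rewrite fineK //.
(* Replacing [f a] by [\1_B] removes [a] from the list of non-indicators, so the induction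
   hypothesis gives the weight condition on [B]. *)
pose g k := if k == a then \1_B else f k.
have gB : (\int[P]_w (\1_B (X a w))%:E = P (X a @^-1` B))%E.
  rewrite -[X in _ = P X]setIT -integral_indic //.
  by rewrite -[X in measurable X]setTI; exact: measurable_funP.
have gne k : k != a -> g k = f k by rewrite /g => /negPf ->.
have ga : g a = \1_B by rewrite /g eqxx.
transitivity (\int[P]_w (\prod_(k in I) g k (X k w))%:E)%E.
  apply: eq_integral => w _; rewrite [in RHS](bigD1 a) //= ga mulrC.
  by congr (_ * _)%:E; apply: eq_bigr => k /andP[_ ka]; rewrite gne.
rewrite IH.
- rewrite (bigD1 a) //= ga gB muleC; congr (_ * _)%E.
  by apply: eq_bigr => k /andP[_ ka]; rewrite gne.
- by move=> k; rewrite /g; case: eqP => // _; exact: measurable_indic.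
- by move=> k x; rewrite /g; case: eqP.
- move=> k kI; have [->|ka] := eqVneq k a; last by rewrite gne // ff.
  by rewrite ga gB (le_lt_trans (probability_le1 _ _)) ?ltry//
    -[X in measurable X]setTI; exact: measurable_funP.
- move=> k kI ks x; have [->|ka] := eqVneq k a.
    by rewrite ga indicE; case: (_ \in _); [right|left].
  by rewrite gne //; apply: f01 => //; rewrite inE negb_or ka.
Qed.

Lemma independent_prod_ge0_integrable (f : K -> R -> R) :
  (forall k, measurable_fun setT (f k)) -> (forall k x, 0 <= f k x) ->
  (forall k, k \in I -> P.-integrable setT (fun w => (f k (X k w))%:E)) ->
  P.-integrable setT (fun w => (\prod_(k in I) f k (X k w))%:E) /\
  (\int[P]_w (\prod_(k in I) f k (X k w))%:E =
   (\prod_(k in I) fine (\int[P]_w (f k (X k w))%:E))%:E)%E.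
Proof.
move=> mf f0 fi.
have fin k : k \in I -> (\int[P]_w (f k (X k w))%:E)%E \is a fin_num.
  by move=> kI; apply: integrable_fin_num => //; exact: fi.
have e : (\int[P]_w (\prod_(k in I) f k (X k w))%:E =
   (\prod_(k in I) fine (\int[P]_w (f k (X k w))%:E))%:E)%E.
  rewrite independent_prod_ge0 // -?prodEFin; last first.
    move=> k kI; rewrite -ge0_fin_numE ?fin// integral_ge0// => w _.
    by rewrite lee_fin.
  by apply: eq_bigr => k kI; rewrite fineK ?fin.
split => //; apply/integrableP; split.
  by apply/measurable_EFinP; exact: measurable_prod_comp.
under eq_integral do rewrite gee0_abs ?lee_fin ?prodr_ge0//.
by rewrite e ltry.
Qed.

(* Expanding each factor into its positive and negative parts reduces the
   signed product rule to the nonnegative one. *)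
Lemma independent_prod (f : K -> R -> R) :
  (forall k, measurable_fun setT (f k)) ->
  (forall k, k \in I -> P.-integrable setT (fun w => (f k (X k w))%:E)) ->
  P.-integrable setT (fun w => (\prod_(k in I) f k (X k w))%:E) /\
  (\int[P]_w (\prod_(k in I) f k (X k w))%:E =
   (\prod_(k in I) fine (\int[P]_w (f k (X k w))%:E))%:E)%E.
Proof.
move=> mf fi.
pose F k (b : bool) : R -> R := if b then (f k)^\- else (f k)^\+.
have mF k b : measurable_fun setT (F k b).
  by case: b; [exact: measurable_funrneg | exact: measurable_funrpos].
have F0 k b x : 0 <= F k b x.
  by case: b; [exact: funrneg_ge0 | exact: funrpos_ge0].
have Fi k b : k \in I -> P.-integrable setT (fun w => (F k b (X k w))%:E).
  move=> kI; case: b.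
    exact: (integrable_funrneg (f := fun w => f k (X k w)) measurableT (fi k kI)).
  exact: (integrable_funrpos (f := fun w => f k (X k w)) measurableT (fi k kI)).
have fE k x : f k x = \sum_(b : bool) (-1) ^+ b * F k b x.
  rewrite big_bool /= expr1 expr0 mul1r mulN1r addrC.
  by rewrite -[in LHS](funrposBneg (f k)).
pose G (g : {ffun K -> bool}) w : R := \prod_(k in I) F k (g k) (X k w).
pose sg (g : {ffun K -> bool}) : R := \prod_(k in I) (-1) ^+ g k.
have GP g := independent_prod_ge0_integrable (fun k => mF k (g k))
  (fun k => F0 k (g k)) (fun k kI => Fi k (g k) kI).
(* Sign choices are frozen to [false] outside [I], so that each choice on [I] is counted once. *)
pose Q := [pred g : {ffun K -> bool} | g \in pffun_on false (mem I) predT].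
have sum_prod (h : K -> bool -> R) :
    \prod_(k in I) \sum_(b : bool) (-1) ^+ b * h k b =
    \sum_(g | Q g) sg g * \prod_(k in I) h k (g k).
  rewrite (big_distr_big false).
  by apply: eq_bigr => g _; rewrite big_split.
have prodE w : (\prod_(k in I) f k (X k w))%:E =
    (\sum_(g | Q g) (sg g)%:E * (G g w)%:E)%E.
  rewrite (eq_bigr _ (fun k _ => fE k (X k w))) sum_prod -sumEFin.
  by apply: eq_bigr => g _; rewrite EFinM.
have iG g : P.-integrable setT (fun w => ((sg g)%:E * (G g w)%:E)%E).
  by apply: integrableZl => //; exact: (GP g).1.
rewrite (_ : (fun w => _) = fun w => (\sum_(g | Q g) (sg g)%:E * (G g w)%:E)%E);
  last exact/funext.
split; first exact: integrable_sum.
rewrite integral_sum //.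
(* The product of the integrals expands over the same sign choices, so the two sums can be compared
   term by term. *)
transitivity (\prod_(k in I) \sum_(b : bool) (-1) ^+ b *
    fine (\int[P]_w (F k b (X k w))%:E))%:E; last first.
  congr (_%:E); apply: eq_bigr => k kI.
  have -> : (\int[P]_w (f k (X k w))%:E =
      \int[P]_w (\sum_(b : bool) ((-1) ^+ b)%:E * (F k b (X k w))%:E))%E.
    by apply: eq_integral => w _; rewrite fE -sumEFin.
  rewrite integral_sum//; last by move=> b; apply: integrableZl => //; exact: Fi.
  rewrite -sum_fine; last first.
    move=> b _; apply: integrable_fin_num => //.
    by apply: integrableZl => //; exact: Fi.
  apply: eq_bigr => b _; rewrite integralZl//; last exact: Fi.
  by rewrite fineM //; apply: integrable_fin_num => //; exact: Fi.
rewrite sum_prod -sumEFin; apply: eq_bigr => g _.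
by rewrite integralZl ?(GP g).2 //; exact: (GP g).1.
Qed.
End independent_products.

(** * Moments of a moment bounded variable *)

Section moments.
Context d (T : measurableType d) (R : realType) (P : probability T R).
Context (Z : {RV P >-> R}).
Hypothesis Zmb : moment_bounded P 1 Z.

(** The recurrence is iterated from the zeroth moment, which is 1. *)
Lemma moment_bounded_fact m : ('E_P[fun w => (`|Z w| ^+ m)%R] <= (m`!%:R)%:E)%E.
Proof.
elim: m => [|m IH].
  rewrite (_ : (fun w => _) = cst 1); first by rewrite expectation_cst.
  by apply/funext => w; rewrite expr0.
apply: le_trans (Zmb (ltn0Sn m)) _.
by rewrite mulr1 factS natrM EFinM lee_wpmul2l // lee_fin.
Qed.

Lemma moment_bounded_integrable m : P.-integrable setT (fun w => (Z w ^+ m)%:E).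
Proof.
apply/integrableP; split.
  by apply/measurable_EFinP; exact: measurable_funX.
under eq_integral do rewrite abse_EFin normrX.
by have := moment_bounded_fact m; rewrite unlock => /le_lt_trans -> //; rewrite ltry.
Qed.

Lemma moment_bounded_moment m :
  `|fine (\int[P]_w (Z w ^+ m)%:E)%E| <= m`!%:R.
Proof.
rewrite -lee_fin -abse_EFin fineK; last first.
  exact: integrable_fin_num (moment_bounded_integrable m).
apply: le_trans (moment_bounded_fact m); rewrite unlock.
apply: le_trans (le_abse_integral _ _ _) _ => //.
  by apply/measurable_EFinP; exact: measurable_funX.
by under eq_integral do rewrite abse_EFin normrX.
Qed.
End moments.

(** Grouping the factors by edge turns a permanent term into a product of powers of distinct, hence
    independent, variables. *)
Lemma prod_sym_of_upper (R : comNzRingType) n (Y : 'I_n -> 'I_n -> R) (p : 'S_n) :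
  \prod_(i < n) (sym_of_upper Y) i (p i) =
  \prod_(e : 'I_n * 'I_n | (e.1 <= e.2)%N) Y e.1 e.2 ^+ #|edges p e|.
Proof.
rewrite (partition_big (fun i => edge i (p i)) (fun e => e.1 <= e.2)%N) /=; last first.
  by move=> i _; exact: edge_le.
apply: eq_bigr => e _; rewrite -prodr_const; apply: eq_big => [i|i].
  by rewrite inE.
by rewrite /edge mxE; case: leqP => _ /eqP <-.
Qed.

(** * Second moment of the permanent *)

Section second_moment.
Context d (T : measurableType d) (R : realType) (P : probability T R).
Context (n : nat) (Y : 'I_n -> 'I_n -> {RV P >-> R}).
Hypothesis indY : mutually_independent P [set ij : 'I_n * 'I_n | (ij.1 <= ij.2)%N]
  (fun ij => (Y ij.1 ij.2 : T -> R)).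
Hypothesis momY : forall i j : 'I_n, (i <= j)%N ->
  moment_bounded P 1 (Y i j) /\ ('E_P[Y i j] = 0)%E.

Let A w : 'M[R]_n := sym_of_upper (fun i j => Y i j w).
Let term (p : 'S_n) w : R := \prod_(i < n) A w i (p i).

Lemma pair_moment (p s : 'S_n) :
  P.-integrable setT (fun w => (term p w * term s w)%:E) /\
  (\int[P]_w (term p w * term s w)%:E <=
   (if covered p s && covered s p then 9 ^+ n else 0)%:E)%E.
Proof.
pose m e := multiplicity p s e.
have termE w : term p w * term s w =
    \prod_(e in [set ij : 'I_n * 'I_n | (ij.1 <= ij.2)%N]%SET) Y e.1 e.2 w ^+ m e.
  rewrite /term !prod_sym_of_upper -big_split /=.
  by apply: eq_big => [e|e _]; [rewrite inE | rewrite -exprD].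
have [] := @independent_prod _ _ _ _ _ _ (fun e => Y e.1 e.2) indY
  (fun e x => x ^+ m e).
- by move=> e; exact: measurable_funX.
- move=> e; rewrite inE => /momY[mY _]; exact: moment_bounded_integrable.
under [X in integrable _ _ X]eq_fun do rewrite -termE.
under [X in (X = _)%E]eq_integral do rewrite -termE.
move=> intg ->; split => //; rewrite lee_fin.
have [cov|ncov] := boolP (covered p s && covered s p).
  apply: le_trans (ler_norm _) _; rewrite normr_prod.
  apply: le_trans (_ : (\prod_(e : 'I_n * 'I_n | (e.1 <= e.2)%N) (m e)`!)%:R <= _);
    last by rewrite -natrX ler_nat prod_fact_multiplicity.
  under eq_bigl do rewrite inE.
  rewrite natr_prod.
  apply: ler_prod => e /momY[mY _].
  by rewrite normr_ge0 moment_bounded_moment.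
(* An uncovered pair has an edge of multiplicity 1, by contraposition of [covered_multiplicity]; its
   factor is a mean, which is 0. *)
have [e el m1] : exists2 e : 'I_n * 'I_n, (e.1 <= e.2)%N & m e = 1%N.
  apply: contrapT => no; move/negP: ncov; apply.
  have nm1 (e : 'I_n * 'I_n) : (e.1 <= e.2)%N -> multiplicity p s e != 1%N.
    by move=> el; apply/eqP => me; apply: no; exists e.
  by rewrite !covered_multiplicity // => e; rewrite multiplicityC; exact: nm1.
rewrite (bigD1 e) /=; last by rewrite inE.
rewrite m1; have [_] := momY el; rewrite unlock => EY.
by under eq_integral do rewrite expr1; rewrite EY mul0r.
Qed.

Lemma measurable_permanent : measurable_fun setT (fun w => permanent (A w)).
Proof.
apply: measurable_sum => p; apply: measurable_prod => i _.
rewrite (_ : (fun w => _) = Y (edge i (p i)).1 (edge i (p i)).2) //.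
by apply/funext => w; rewrite /A mxE /edge; case: leqP.
Qed.

Lemma permanent_second_moment :
  (\int[P]_w (permanent (A w) ^+ 2)%:E <= (36 ^+ n * n`!%:R)%:E)%E.
Proof.
have sqE w : (permanent (A w) ^+ 2)%:E =
    (\sum_(ps : 'S_n * 'S_n) (term ps.1 w * term ps.2 w)%:E)%E.
  rewrite sumEFin expr2 /permanent big_distrlr /=.
  by rewrite (pair_bigA _ (fun p s => term p w * term s w)).
under eq_integral do rewrite sqE.
rewrite integral_sum//; last by move=> ps; exact: (pair_moment _ _).1.
apply: le_trans (lee_sum _ (fun ps _ => (pair_moment ps.1 ps.2).2)) _.
rewrite sumEFin lee_fin -big_mkcond /= sumr_const.
(* The 9 comes from the moments of a pair and the 4 from the number of covered pairs. *)
rewrite -[leLHS]mulr_natr (_ : 36 = 9 * 4 :> R); last by rewrite -natrM.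
rewrite exprMn -mulrA ler_wpM2l ?exprn_ge0 // -natrX -natrM ler_nat.
rewrite mulnC; apply: leq_trans card_covered.
by rewrite cardsE.
Qed.
End second_moment.

(** * The tail bound *)

Theorem theorem6 (R : realType) :
  exists c : R, 0 < c /\
  forall (n : nat) (d : measure_display) (T : measurableType d)
         (P : probability T R) (Y : 'I_n -> 'I_n -> {RV P >-> R}),
    mutually_independent P [set ij : 'I_n * 'I_n | (ij.1 <= ij.2)%N]
      (fun ij => (Y ij.1 ij.2 : T -> R)) ->
    (forall i j : 'I_n, (i <= j)%N ->
       moment_bounded P 1 (Y i j) /\ ('E_P[Y i j] = 0)%E) ->
    forall t : R, 0 < t ->
      (P [set w | (t * Num.sqrt (n`!)%:R <=
                  `|permanent (sym_of_upper (fun i j => Y i j w))|)%R ]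
       <= (Num.max (expR (- n%:R))
                   (expR 2 * expR (- c * t `^ (2 / n%:R)))) %:E)%E.
Proof.
pose C : R := 36 * expR 1.
have C0 : 0 < C by rewrite mulr_gt0 ?expR_gt0.
exists (2 / C); split; first by rewrite divr_gt0.
move=> n d T P Y indY momY t t0.
set E := (X in P X); set u := t `^ (2 / n%:R).
have u0 : 0 < u by exact: powR_gt0.
have mperm := measurable_permanent Y.
have mE : measurable E.
  rewrite (_ : E = (fun w => `|permanent (sym_of_upper (fun i j => Y i j w))|) @^-1`
    `[t * Num.sqrt (n`!)%:R, +oo[); last first.
    by apply/seteqP; split => w; rewrite /E /= in_itv /= andbT.
  rewrite -[X in measurable X]setTI.
  by apply: (measurableT_comp (@normr_measurable _ _) mperm).
have [Cu|uC] := leP C u; last first.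
  apply: le_trans (probability_le1 _ mE) _; rewrite lee_fin le_max; apply/orP; right.
  rewrite -expRD -expR0 ler_expR mulNr subr_ge0 mulrAC ler_pdivrMr // ler_pM2l //.
  exact: ltW.
(* For [n = 0] the identity [t ^+ 2 = u ^+ n] used below may fail, since [2 / 0 = 0]; but there the
   first term of the maximum is 1. *)
have [n0|n0] := posnP n.
  apply: le_trans (probability_le1 _ mE) _; rewrite lee_fin le_max; apply/orP; left.
  by rewrite n0 oppr0 expR0.
apply: (@le_trans _ _ (expR (- n%:R))%:E); last by rewrite lee_fin le_max lexx.
pose a : R := t ^+ 2 * n`!%:R.
have a0 : 0 < a by rewrite mulr_gt0 ?exprn_gt0 ?ltr0n ?fact_gt0.
have tu : t ^+ 2 = u ^+ n.
  rewrite -powR_mulrn ?ltW // -powR_mulrn ?ltW // /u -powRrM.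
  by rewrite divfK // pnatr_eq0 -lt0n.
(* Markov's inequality: [a] times the indicator of [E] is at most the squared permanent. *)
have markov2 : (a%:E * P E <= (36 ^+ n * n`!%:R)%:E)%E.
  apply: le_trans (permanent_second_moment indY momY).
  rewrite -[X in P X]setIT -integral_indic // -ge0_integralZl //; last 2 first.
  - by apply/measurable_EFinP; exact: measurable_indic.
  - by rewrite lee_fin ltW.
  apply: ge0_le_integral => //.
  - by move=> w _; rewrite -EFinM lee_fin mulr_ge0 // ltW.
  - by apply/measurable_EFinP/measurable_funM => //; exact: measurable_indic.
  - by apply/measurable_EFinP; exact: measurable_funX.
  move=> w _; rewrite -EFinM lee_fin indicE.
  case: (boolP (w \in E)) => [|_]; last by rewrite mulr0 sqr_ge0.
  rewrite inE /E /= mulr1 => Ew.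
  rewrite -[X in _ <= X]real_normK ?num_real // /a -[X in _ * X]sqr_sqrtr ?ler0n //.
  by rewrite -exprMn lerXn2r ?nnegrE ?mulr_ge0 ?sqrtr_ge0 ?(ltW t0).
rewrite -(@lee_pmul2l _ a%:E) ?lte_fin //; apply: le_trans markov2 _.
rewrite -EFinM lee_fin /a tu mulrAC ler_wpM2r ?ler0n //.
(* The factor [expR 1] in [C] cancels [expR (- n%:R)], leaving [36 ^+ n]; then [C <= u] applies. *)
apply: (@le_trans _ _ (C ^+ n * expR (- n%:R))); last first.
  by rewrite ler_wpM2r ?expR_ge0 // lerXn2r ?nnegrE ?(ltW C0) ?(ltW u0).
by rewrite /C exprMn -expRM_natl mulr1 -mulrA -expRD subrr expR0 mulr1.
Qed.
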